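(* Let $\Phi(x)=x\lfloor 1/x\rfloor$ on $(0,1]$. Let $\beta\ge0$ be real and let $(a_n)_{n\ge1}$ be the real sequence with $a_1=1$ and $\sum_{k=1}^{n}a_k\Phi\left(\frac{k}{n}\right)=n^{-\beta}$ for all $n\ge2$. Then $na_n=O(1)$ as $n\to\infty$. *)

(* Defs.v *)
From HB Require Import structures.
From mathcomp Require Import all_boot all_order all_algebra.
From mathcomp Require Import all_classical all_reals all_analysis.
Set Implicit Arguments.
Unset Strict Implicit.
Unset Printing Implicit Defensive.
Import Order.TTheory GRing.Theory Num.Theory.
Import numFieldNormedType.Exports.
Local Open Scope ring_scope.

(* Only meaningful on ]0, 1]; extended to R by the same formula. *)
Definition Phi (R : realType) (x : R) : R := x * (Num.floor (1 / x))%:~R.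

(* Main.v *)
Require Import Defs.
From HB Require Import structures.
From mathcomp Require Import all_boot all_order all_algebra.
From mathcomp Require Import all_classical all_reals all_analysis.
From mathcomp Require Import lra.
Set Implicit Arguments.
Unset Strict Implicit.
Unset Printing Implicit Defensive.
Import Order.TTheory GRing.Theory Num.Theory.
Import numFieldNormedType.Exports.
Local Open Scope ring_scope.
Local Open Scope classical_set_scope.

(** Put [b k = k * a k]. The hypothesis says
    [\sum_(k <= n) b k * (n %/ k) = n `^ (1 - beta)], so differencing in [n]
    gives [\sum_(d %| n) b d = n `^ (1 - beta) - (n - 1) `^ (1 - beta)], and by
    the mean value theorem this is [(1 - beta) * n `^ (- beta)] up to an error
    at most [`|1 - beta| * ((n - 1) `^ (- beta) - n `^ (- beta))], which is
    summable by telescoping. Möbius inversion sends the completely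
    multiplicative main term to a function bounded by [`|1 - beta|], because
    each Euler factor [p `^ (- beta * k) - p `^ (- beta * (k - 1))] lies in
    [[-1, 0]], and it sends the error to something bounded by its total mass.
    The inversion is carried out one prime at a time, by induction. *)

(** Split the divisors by their exponent of [p]: those not divisible by [p ^ k.+1] divide
    [p ^ k * m], and the others are [p ^ k.+1] times a divisor of [m]. *)
Lemma perm_divisors_pfactor (p m k : nat) :
  prime p -> coprime p m -> (0 < m)%N ->
  perm_eq (divisors (p ^ k.+1 * m))
    (divisors (p ^ k * m) ++ [seq p ^ k.+1 * d | d <- divisors m])%N.
Proof.
move=> p_pr co_pm m_gt0; have p_gt0 := prime_gt0 p_pr.
have pk_gt0 j : (0 < p ^ j)%N by rewrite expn_gt0 p_gt0.
have n_gt0 j : (0 < p ^ j * m)%N by rewrite muln_gt0 pk_gt0.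
have dvd_k1 d : (p ^ k.+1 * d %| p ^ k * m)%N = false.
  apply/negP => /(dvdn_trans (dvdn_mulr _ (dvdnn _))).
  rewrite expnSr dvdn_pmul2l// => p_m.
  by move: co_pm; rewrite prime_coprime// p_m.
apply: uniq_perm; first exact: divisors_uniq.
  rewrite cat_uniq divisors_uniq /= map_inj_uniq ?divisors_uniq ?andbT.
    apply/hasPn => _ /mapP[d _ ->] /=.
    by rewrite -dvdn_divisors// dvd_k1.
  by move=> x y /eqP; rewrite eqn_pmul2l// => /eqP.
move=> d; rewrite mem_cat -!dvdn_divisors//; apply/idP/orP => [d_n|]; last first.
  case=> [/dvdn_trans->//|]; first by rewrite expnS -mulnA dvdn_mull.
  by case/mapP => e; rewrite -dvdn_divisors// => e_m ->; rewrite dvdn_pmul2l.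
have d_gt0 : (0 < d)%N := dvdn_gt0 (n_gt0 _) d_n.
have [pk_d|pk_d] := boolP (p ^ k.+1 %| d)%N.
  right; move: d_n; case/dvdnP: pk_d => e ->; rewrite mulnC => d_n.
  apply/mapP; exists e => //; rewrite -dvdn_divisors//.
  by rewrite -(dvdn_pmul2l (pk_gt0 k.+1)).
left; have [e co_pe d_e] := pfactor_coprime p_pr d_gt0.
rewrite d_e mulnC; apply: dvdn_mul.
  by apply: dvdn_exp2l; move: pk_d; rewrite pfactor_dvdn// -leqNgt.
have : (e %| p ^ k.+1 * m)%N by apply: dvdn_trans d_n; rewrite d_e dvdn_mulr.
by rewrite Gauss_dvdr// coprime_sym coprimeXl.
Qed.

Lemma perm_divisors_iota (n : nat) : (0 < n)%N ->
  perm_eq (divisors n) [seq d <- index_iota 1 n.+1 | (d %| n)%N].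
Proof.
move=> n_gt0; apply: uniq_perm; rewrite ?divisors_uniq ?filter_uniq ?iota_uniq//.
move=> d; rewrite -dvdn_divisors// mem_filter mem_index_iota.
apply/idP/andP => [dn|[]//]; split=> //.
by rewrite (dvdn_gt0 n_gt0 dn) ltnS dvdn_leq.
Qed.

Section DivisorSums.
Variable R : realType.
Implicit Types (g f E : nat -> R).

Lemma sum_divisors_pfactor f (p m k : nat) :
  prime p -> coprime p m -> (0 < m)%N ->
  \sum_(d <- divisors (p ^ k.+1 * m)) f d =
  \sum_(d <- divisors (p ^ k * m)) f d +
  \sum_(d <- divisors m) f (p ^ k.+1 * d)%N.
Proof.
move=> p_pr co_pm m_gt0.
by rewrite (perm_big _ (perm_divisors_pfactor k p_pr co_pm m_gt0)) big_cat big_map.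
Qed.

Lemma le_sum_divisors_pfactor f (p m k : nat) :
  (forall d, 0 <= f d) -> prime p -> coprime p m -> (0 < m)%N ->
  \sum_(d <- divisors m) f (p ^ k * d)%N <=
  \sum_(d <- divisors (p ^ k * m)) f d.
Proof.
move=> f0 p_pr co_pm m_gt0; case: k => [|k].
  by rewrite expn0 mul1n; under eq_bigr do rewrite mul1n.
by rewrite sum_divisors_pfactor// lerDr sumr_ge0.
Qed.

(** Strong induction on [n = p ^ k.+1 * m], with [c], [E] and [f] general: the step to [m] replaces
    all three, and only [g] stays fixed. *)
Lemma norm_le_of_sum_divisors g E f (c : R) (n : nat) :
  (forall x y, g (x * y)%N = g x * g y) -> g 1%N = 1 ->
  (forall x, (0 < x)%N -> 0 <= g x <= 1) -> (0 < n)%N ->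
  (forall d, (d %| n)%N -> \sum_(e <- divisors d) f e = c * g d + E d) ->
  `|f n| <= `|c| + \sum_(d <- divisors n) `|E d|.
Proof.
move=> gM g1 g01; elim/ltn_ind: n => n IH in c E f *.
move=> n_gt0 fE.
have [n1|n_gt1] := leqP n 1.
  have {IH}n_e : n = 1%N by apply/eqP; rewrite eqn_leq n1.
  move: fE; rewrite n_e => fE; move: (fE 1%N (dvdnn _)); rewrite (_ : divisors 1 = [:: 1%N])//.
  by rewrite !big_seq1 g1 mulr1 => ->; rewrite ler_normD.
have p_pr := pdiv_prime n_gt1; set p := pdiv n in p_pr.
have [m co_pm] := pfactor_coprime p_pr n_gt0.
have : (0 < logn p n)%N by rewrite logn_gt0 mem_primes p_pr n_gt0 pdiv_dvd.
case: (logn p n) => // k _; rewrite mulnC => n_e.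
have m_gt0 : (0 < m)%N by move: n_gt0; rewrite n_e muln_gt0 => /andP[].
have p_gt0 := prime_gt0 p_pr.
have m_n : (m < n)%N.
  rewrite n_e ltn_Pmull// -(expn0 p) ltn_exp2l//; exact: prime_gt1.
have dvd_k d : (d %| m)%N -> (p ^ k.+1 * d %| n)%N.
  by move=> dm; rewrite n_e dvdn_pmul2l// expn_gt0 p_gt0.
have dvd_k' d : (d %| m)%N -> (p ^ k * d %| n)%N.
  by move=> /dvd_k; apply: dvdn_trans; rewrite expnS -mulnA dvdn_mull.
(* Differencing along powers of [p] isolates the values of [f] on
   [p ^ k.+1 * d] with [d %| m]. *)
have := IH m m_n (c * (g (p ^ k.+1)%N - g (p ^ k)%N))
  (fun d => E (p ^ k.+1 * d)%N - E (p ^ k * d)%N)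
  (fun d => f (p ^ k.+1 * d)%N) m_gt0.
rewrite -n_e => /(_ _)/le_trans; apply.
  move=> d dm; have d_gt0 := dvdn_gt0 m_gt0 dm.
  have co_pd : coprime p d by apply: coprime_dvdr co_pm.
  have := sum_divisors_pfactor f k p_pr co_pd d_gt0.
  rewrite fE ?dvd_k// fE ?dvd_k'// !gM => H.
  by move: H; lra.
apply: lerD.
  (* Two values of [g] in [[0, 1]] differ by at most 1, so the new constant is no larger than [c] in
     absolute value. *)
  rewrite normrM ler_piMr// ler_norml.
  have /g01/andP[] : (0 < p ^ k)%N by rewrite expn_gt0 p_gt0.
  have /g01/andP[] : (0 < p ^ k.+1)%N by rewrite expn_gt0 p_gt0.
  lra.
(* The numbers [p ^ k.+1 * d] and [p ^ k * d] with [d %| m] are distinct divisors of [n], so no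
   error term is counted twice. *)
rewrite n_e (sum_divisors_pfactor (fun d => `|E d|))// addrC.
apply: le_trans (_ : _ <= \sum_(d <- divisors m)
  (`|E (p ^ k.+1 * d)%N| + `|E (p ^ k * d)%N|)) _.
  by apply: ler_sum => d _; exact: ler_normB.
by rewrite big_split lerD2l (le_sum_divisors_pfactor (f := fun d => `|E d|)).
Qed.

(** Passing from [n] to [n.+1] raises the quotient by [k] by 1 exactly when [k] divides [n.+1]. The
    second sum may be extended to [k = n.+1], where its quotient is 0. *)
Lemma sum_divn_sub f (n : nat) :
  \sum_(1 <= k < n.+2) f k * (n.+1 %/ k)%:R -
  \sum_(1 <= k < n.+1) f k * (n %/ k)%:R = \sum_(d <- divisors n.+1) f d.
Proof.
rewrite (perm_big _ (perm_divisors_iota (ltn0Sn n))) big_filter [RHS]big_mkcond /=.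
have -> : \sum_(1 <= k < n.+1) f k * (n %/ k)%:R =
          \sum_(1 <= k < n.+2) f k * (n %/ k)%:R.
  by rewrite [RHS]big_nat_recr//= divn_small// mulr0 addr0.
rewrite -sumrB; apply: eq_big_nat => d /andP[d_gt0 _].
rewrite divnS// natrD mulrDr addrK.
by case: (_ %| _)%N; rewrite ?mulr1 ?mulr0.
Qed.

Lemma Phi_natdiv (k n : nat) : (0 < k)%N -> (0 < n)%N ->
  n%:R * Phi (k%:R / n%:R : R) = k%:R * (n %/ k)%:R.
Proof.
move=> k_gt0 n_gt0.
have k0 : 0 < k%:R :> R by rewrite ltr0n.
have n0 : n%:R != 0 :> R by rewrite pnatr_eq0 -lt0n.
rewrite /Phi div1r invf_div (@floor_def _ _ (n %/ k)%N).
  by rewrite mulrA mulrCA divff// mulr1.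
rewrite -[_ + 1]/((n %/ k)%:Z + 1%:Z) -PoszD addn1 -!pmulrn.
rewrite ler_pdivlMr// ltr_pdivrMr// -!natrM ler_nat ltr_nat leq_divM.
exact: ltn_ceil.
Qed.

Lemma powR_decr (beta x y : R) : 0 <= beta -> 0 < x -> x <= y ->
  y `^ (- beta) <= x `^ (- beta).
Proof.
move=> b0 x0 xy; have y0 : 0 < y by apply: lt_le_trans xy.
rewrite !powRN lef_pV2 ?posrE ?powR_gt0//.
by apply: ge0_ler_powR => //; rewrite nnegrE ltW.
Qed.

Lemma powR_diff_approx (beta : R) (n : nat) : 0 <= beta -> (0 < n)%N ->
  `|n.+1%:R `^ (1 - beta) - n%:R `^ (1 - beta)
    - (1 - beta) * n.+1%:R `^ (- beta)| <=
  `|1 - beta| * (n%:R `^ (- beta) - n.+1%:R `^ (- beta)).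
Proof.
move=> b0 n_gt0; have n0 : 0 < n%:R :> R by rewrite ltr0n.
have nn1 : n%:R < n.+1%:R :> R by rewrite ltr_nat.
have [||x xI ->] := @MVT R (@powR R ^~ (1 - beta))
  (fun x => (1 - beta) * x `^ (1 - beta - 1)) _ _ nn1.
- move=> x; rewrite in_itv/= => /andP[nx _].
  exact/is_derive1_powR/(lt_trans n0).
- apply: derivable_within_continuous => x; rewrite in_itv/= => /andP[nx _].
  by apply: derivable_powR; rewrite in_itv/= andbT (lt_le_trans n0).
move: xI; rewrite in_itv/= => /andP[nx xn].
rewrite -[n.+1%:R - _]natrB// subSnn mulr1 -mulrBr normrM addrAC subrr add0r.
apply: ler_wpM2l => //; rewrite ger0_norm ?subr_ge0 ?lerD2r.
  by apply: powR_decr => //; exact: ltW.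
by apply: powR_decr (ltW xn) => //; exact: lt_trans nx.
Qed.

End DivisorSums.

Theorem theorem2p3 (R : realType) (beta : R) (hbeta : 0 <= beta)
  (a : nat -> R) (ha1 : a 1%N = 1)
  (ha : forall n : nat, (2 <= n)%N ->
     \sum_(1 <= k < n.+1) a k * Phi (k%:R / n%:R) = n%:R `^ (- beta)) :
  (fun n : nat => n%:R * a n) =O_\oo (fun=> 1 : R).
Proof.
pose b (n : nat) : R := n%:R * a n.
pose g (n : nat) : R := n%:R `^ (- beta).
pose E (n : nat) : R := \sum_(d <- divisors n) b d - (1 - beta) * g n.
have sum_b n : (0 < n)%N ->
    \sum_(1 <= k < n.+1) b k * (n %/ k)%:R = n%:R `^ (1 - beta).
  case: n => [//|[_|n _]].
    (* The recurrence starts at 2; at 1 the identity comes from [a 1 = 1]. *)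
    by rewrite big_nat1 /b ha1 powR1 !mulr1.
  rewrite powRD; last by rewrite pnatr_eq0 implybT.
  rewrite powRr1// -ha// mulr_sumr; apply: eq_big_nat => k /andP[k_gt0 _].
  by rewrite mulrCA Phi_natdiv// mulrA /b [_ * a k]mulrC.
have E1 : E 1%N = beta.
  by rewrite /E (_ : divisors 1 = [:: 1%N])// big_seq1 /b /g ha1 powR1; lra.
have E_le n : (0 < n)%N -> `|E n.+1| <= `|1 - beta| * (g n - g n.+1).
  move=> n_gt0; rewrite /E -sum_divn_sub !sum_b//.
  exact: powR_diff_approx.
have g_ge0 n : 0 <= g n by exact: powR_ge0.
(* The bounds [E_le] telescope from [g 1 = 1]; the term [E 1 = beta] is kept apart. *)
have sumE n : (0 < n)%N ->
    \sum_(1 <= d < n.+1) `|E d| <= beta + `|1 - beta| * (1 - g n).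
  elim: n => // -[_ _|n IH _].
    by rewrite big_nat1 E1 ger0_norm// /g powR1 subrr mulr0 addr0.
  rewrite big_nat_recr//=; apply: le_trans (lerD (IH _) (E_le _ _)) _ => //.
  by rewrite -addrA -mulrDr lerD2l ler_wpM2l//; lra.
have b_le n : (0 < n)%N -> `|b n| <= `|1 - beta| + (beta + `|1 - beta|).
  move=> n_gt0.
  have := @norm_le_of_sum_divisors R g E b (1 - beta) n.
  move=> /(_ _ _ _ n_gt0 _)/le_trans; apply => //.
  - by move=> x y; rewrite /g natrM powRM.
  - by rewrite /g powR1.
  - move=> x x_gt0; rewrite g_ge0 /=.
    have : 1 <= x%:R :> R by rewrite ler1n.
    by move=> /(powR_decr hbeta ltr01); rewrite powR1.
  - by move=> d _; rewrite /E addrC subrK.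
  (* Enlarging the divisor sum to all [d <= n] gives a bound uniform in [n], because [g n >= 0]. *)
  rewrite lerD2l (perm_big _ (perm_divisors_iota n_gt0)) big_filter.
  apply: le_trans (_ : _ <= \sum_(1 <= d < n.+1) `|E d|) _.
    rewrite big_mkcond; apply: ler_sum => d _; by case: ifP.
  apply: le_trans (sumE _ n_gt0) _.
  by rewrite lerD2l ler_piMr// gerBl.
apply/eqO_exP; exists (`|1 - beta| + (beta + `|1 - beta|) + 1).
  by rewrite ltr_wpDl// !addr_ge0.
exists 1%N => // n /= n_gt0.
by rewrite normr1 mulr1 (le_trans (b_le n n_gt0))// lerDl.
Qed.
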